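(* There is an absolute constant $c$ such that for every $n$ and every $\alpha>9n$, the price of anarchy of the sum network creation game with $n$ players and link price $\alpha$ is at most $c$.
   Context: Sum network creation game: players $V=\{1,\dots,n\}$ and a parameter $\alpha>0$. A strategy of player $u$ is a set $s_u\subseteq V\setminus\{u\}$; a strategy vector is $s=(s_u)_{u\in V}$. The graph $G_s$ has vertex set $V$ and an edge $uv$ whenever $v\in s_u$ or $u\in s_v$. The cost of player $u$ is $c_u(s)=\alpha|s_u|+\sum_{v\neq u} d_{G_s}(u,v)$ (distances infinite if disconnected), and the social cost is $c(s)=\sum_u c_u(s)$. A Nash equilibrium is a strategy vector $s$ such that no player can strictly decrease his cost by changing only his own strategy. If $E$ is the set of Nash equilibria, the price of anarchy is $\max_{s\in E}c(s)/\min_s c(s)$. *)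

(* Defs.v *)
From HB Require Import structures.
From mathcomp Require Import all_boot all_order all_algebra.
From mathcomp Require Import reals constructive_ereal.
Set Implicit Arguments. Unset Strict Implicit. Unset Printing Implicit Defensive.
Import Order.TTheory GRing.Theory Num.Theory.
Local Open Scope ring_scope.

Definition strat (n : nat) := {ffun 'I_n -> {set 'I_n}}.

Definition valid_strategy n (u : 'I_n) (A : {set 'I_n}) : bool := u \notin A.
Definition valid n (s : strat n) : bool := [forall u, valid_strategy u (s u)].

Definition edge n (s : strat n) (u v : 'I_n) : bool := (v \in s u) || (u \in s v).

Fixpoint ball n (s : strat n) (k : nat) (u : 'I_n) : {set 'I_n} :=
  match k with
  | 0 => [set u]
  | k'.+1 => ball s k' u :|: [set v | [exists w in ball s k' u, edge s w v]]
  end.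

(** Graph distance d_{G_s}(u,v) in \bar R: the least k with v in ball s k u
    (a shortest path has at most n-1 <= n edges), or +oo if disconnected. *)
Definition dist (R : realType) n (s : strat n) (u v : 'I_n) : \bar R :=
  if v \in ball s n u
  then ((find (fun k => v \in ball s k u) (iota 0 n.+1))%:R : R)%:E
  else +oo%E.

Definition player_cost (R : realType) n (alpha : R) (s : strat n) (u : 'I_n)
  : \bar R :=
  ((alpha * #|s u|%:R)%:E + \sum_(v | v != u) dist R s u v)%E.

Definition social_cost (R : realType) n (alpha : R) (s : strat n) : \bar R :=
  (\sum_u player_cost alpha s u)%E.

Definition deviate n (s : strat n) (u : 'I_n) (t : {set 'I_n}) : strat n :=
  [ffun v => if v == u then t else s v].

Definition nash (R : realType) n (alpha : R) (s : strat n) : Prop :=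
  valid s /\
  forall (u : 'I_n) (t : {set 'I_n}), valid_strategy u t ->
    (player_cost alpha s u <= player_cost alpha (deviate s u t) u)%E.

(** "Price of anarchy <= c": every equilibrium's social cost is at most c
    times the social cost of every strategy vector (hence of the optimum),
    i.e. max_{s in E} c(s) <= c * min_s c(s). *)
Definition poa_le (R : realType) n (alpha c : R) : Prop :=
  forall s s' : strat n, nash alpha s -> valid s' ->
    (social_cost alpha s <= c%:E * social_cost alpha s')%E.

(* Main.v *)
Require Import Defs.
From HB Require Import structures.
From mathcomp Require Import all_boot all_order all_algebra.
From mathcomp Require Import reals constructive_ereal.
From mathcomp Require Import zify lra.
Import Order.TTheory GRing.Theory Num.Theory.
Set Implicit Arguments. Unset Strict Implicit. Unset Printing Implicit Defensive.
Local Open Scope nat_scope.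

(** In an equilibrium with [alpha > 9 n] the graph is a tree. Let [r] minimise the
distance sum and let [T] be a breadth-first tree rooted at [r]. If a player owns
two edges each of which is outside [T], or is his tree edge to his parent, or
leads down to the owner of a non-tree edge at most four levels below, then
replacing all of them by one edge to [r] saves [alpha] and costs at most [9 n].
Hence the owners of non-tree edges sit at the ends of pairwise disjoint downward
chains, and inside a 2-edge-connected block [H] at least half of the vertices
have degree two and are bought by a neighbour. For such a vertex [v] bought by
[u], swapping [uv] for an edge to the other neighbour of [v] shows that at least
half of the vertices that [u] reaches through [v] hang off [H] at [v], while
deleting [uv] lengthens only the distances to these vertices, by less than
[|H|]; so more than [9 n / (2 |H|)] vertices hang off [H] at [v]. Summing over
[v] counts more than [n] vertices.

For a tree, [r] is a centroid, and a player far from [r] would profit from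
buying an edge to [r]; this bounds the depth by [O (alpha / n)]. *)

(** * Walks and balls *)

Section Ball.
Variables (n : nat) (s : strat n).

Lemma edge_sym : symmetric (edge s).
Proof. by move=> u v; rewrite /edge orbC. Qed.

Lemma ballP k u v :
  reflect (exists p, [/\ path (edge s) u p, last u p = v & size p <= k])
          (v \in ball s k u).
Proof.
apply: (iffP idP); elim: k v => [|k IHk] v /=.
- by rewrite inE => /eqP ->; exists [::].
- rewrite !inE => /orP[/IHk[p [pp lp sp]]|/existsP[w /andP[/IHk[p [pp lp sp]] wv]]].
    by exists p; split=> //; apply: leqW.
  exists (rcons p v); rewrite rcons_path last_rcons size_rcons pp lp wv.
  by split.
- by case=> -[|x p] [] // _ <- _; rewrite inE.
- case; elim/last_ind=> [|p x _] [].
    move=> _ <- _; rewrite inE; apply/orP; left.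
    by apply: IHk; exists [::].
  rewrite rcons_path last_rcons size_rcons ltnS => /andP[pp lx] <- sp.
  rewrite !inE; apply/orP; right; apply/existsP; exists (last u p).
  by rewrite lx andbT; apply: IHk; exists p.
Qed.

Lemma ball_refl k u : u \in ball s k u.
Proof. by apply/ballP; exists [::]. Qed.

Lemma ball_le k l u v : k <= l -> v \in ball s k u -> v \in ball s l u.
Proof.
move=> kl /ballP[p [pp lp sp]]; apply/ballP; exists p; split=> //.
exact: leq_trans sp kl.
Qed.

Lemma ball_trans k l u v w :
  v \in ball s k u -> w \in ball s l v -> w \in ball s (k + l) u.
Proof.
move=> /ballP[p [pp lp sp]] /ballP[q [pq lq sq]]; apply/ballP; exists (p ++ q).
by rewrite cat_path last_cat size_cat lp pp pq leq_add.
Qed.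

Lemma ball_edge u v : edge s u v -> v \in ball s 1 u.
Proof. by move=> uv; apply/ballP; exists [:: v]; rewrite /= uv. Qed.

Lemma ball_sym k u v : (v \in ball s k u) = (u \in ball s k v).
Proof.
have imp x y : y \in ball s k x -> x \in ball s k y.
  move=> /ballP[p [pp <- sp]]; apply/ballP; exists (rev (belast x p)).
  rewrite rev_path size_rev size_belast; split=> //.
    by rewrite (eq_path (e' := edge s)) // => a b; rewrite edge_sym.
  by case: p {pp sp} => //= a p; rewrite rev_cons last_rcons.
by apply/idP/idP; apply: imp.
Qed.

Lemma ball_short k u v : v \in ball s k u -> v \in ball s n u.
Proof.
move=> /ballP[p [pp <- _]].
case/shortenP: pp => q pq uq _; apply/ballP; exists q; split=> //.
by have := max_card [in u :: q]; rewrite (card_uniqP uq) card_ord; apply: ltnW.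
Qed.

End Ball.

(** * Graph distance as a natural number *)

Section Distance.
Variables (n : nat) (s : strat n).

(** The finite branch of [dist], kept in [nat]; the value is [n.+1] if [v] is unreachable from
    [u]. *)
Definition gd (u v : 'I_n) : nat := find (fun k => v \in ball s k u) (iota 0 n.+1).

Lemma gd_min k u v : v \in ball s k u -> gd u v <= k.
Proof.
move=> vk; rewrite leqNgt; apply/negP => lt_k.
have lt_n : k < n.+1.
  by apply: leq_trans lt_k _; rewrite -[X in _ <= X](size_iota 0) find_size.
by have := before_find 0 lt_k; rewrite nth_iota // vk.
Qed.

Lemma gd_refl u : gd u u = 0.
Proof. by apply/eqP; rewrite -leqn0 gd_min // ball_refl. Qed.

Lemma gd_sym u v : gd u v = gd v u.
Proof. by apply: eq_find => k; rewrite ball_sym. Qed.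

Hypothesis conn : forall u v, v \in ball s n u.

Lemma gd_ball u v : v \in ball s (gd u v) u.
Proof.
have hv : has (fun k => v \in ball s k u) (iota 0 n.+1).
  by apply/hasP; exists n; rewrite ?conn // mem_iota add0n ltnSn.
have := nth_find 0 hv; rewrite nth_iota //.
by rewrite -[X in _ < X](size_iota 0) -has_find.
Qed.

Lemma gd_tri u v w : gd u w <= gd u v + gd v w.
Proof. exact/gd_min/ball_trans/gd_ball/gd_ball. Qed.

Lemma gd_eq0 u v : (gd u v == 0) = (u == v).
Proof.
apply/eqP/eqP => [d0|->]; last exact: gd_refl.
by have := gd_ball u v; rewrite d0 inE => /eqP.
Qed.

Lemma gd_edge u v w : edge s u v -> gd u w <= (gd v w).+1.
Proof.
move=> uv; apply: leq_trans (gd_tri u v w) _.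
by rewrite -add1n leq_add2r; apply/gd_min/ball_edge.
Qed.

Lemma gd_next u w : u != w -> exists2 z, edge s u z & gd u w = (gd z w).+1.
Proof.
move=> uw; have /ballP[[|z p] [pp lp sp]] := gd_ball u w.
  by move: uw; rewrite -lp eqxx.
move: pp sp => /= /andP[uz pp] sp; exists z => //.
apply/eqP; rewrite eqn_leq gd_edge //= (leq_trans _ sp) // ltnS.
by apply: gd_min; apply/ballP; exists p.
Qed.

Lemma gd_path u w : exists p,
  [/\ path (edge s) u p, last u p = w, uniq (u :: p)
    & forall x, x \in u :: p -> gd u w = gd u x + gd x w].
Proof.
move: {2}(gd u w) (erefl (gd u w)) => m.
elim: m u => [|m IHm] u.
  move=> /eqP; rewrite gd_eq0 => /eqP <-; exists [::]; split=> // x.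
  by rewrite inE => /eqP ->; rewrite gd_refl.
move=> dm; have uw : u != w by rewrite -gd_eq0 dm.
have [z uz dz] := gd_next uw.
have [|p [pp lp up gp]] := IHm z; first by move: dm; rewrite dz => -[].
exists (z :: p); split=> //=.
- by rewrite uz.
- rewrite -[X in _ && X]/(uniq (z :: p)) up andbT.
  by apply/negP => /gp gu; lia.
- move=> x; rewrite inE => /orP[/eqP ->|/gp gx]; first by rewrite gd_refl.
  by have := gd_tri u x w; have := gd_edge x uz; lia.
Qed.

(* A geodesic to [w] starting closer to [w] than [u] never meets [u]. *)
Lemma dev_ball u t z w :
  gd z w < gd u w -> w \in ball (deviate s u t) (gd z w) z.
Proof.
move: {2}(gd z w) (erefl (gd z w)) => m.
elim: m z => [|m IHm] z dz lt_z.
  by move: (dz) => /eqP; rewrite gd_eq0 => /eqP ->; rewrite ball_refl.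
have zw : z != w by rewrite -gd_eq0 dz.
have [y zy dy] := gd_next zw; rewrite dy in lt_z *.
have zu : z != u by apply: contraTneq lt_z => <-; rewrite dy ltnn.
have yu : y != u by apply: contraTneq lt_z => ->; lia.
have dm : gd y w = m by lia.
rewrite -add1n; apply: (@ball_trans _ _ _ _ _ y); last by apply: IHm => //; lia.
apply: ball_edge; move: zy; rewrite /edge !ffunE.
by rewrite (negPf zu) (negPf yu).
Qed.

End Distance.

Lemma sum_pred_le1 (T : finType) (A : {set T}) (P : pred T) :
  (forall a b, a \in A -> b \in A -> P a -> P b -> a = b) ->
  \sum_(a in A) P a <= 1.
Proof.
move=> uniqP; rewrite -big_mkcondr sum1dep_card.
apply/card_le1_eqP => a b; rewrite !inE => /andP[aA Pa] /andP[bA Pb].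
exact: uniqP.
Qed.

(** * Deleting links in an equilibrium *)

Section Deviations.
Variables (n : nat) (s : strat n).

Lemma dev_edge u (t : {set 'I_n}) x y :
  edge s x y -> (x = u -> y \in s u -> y \in t) ->
  (y = u -> x \in s u -> x \in t) -> edge (deviate s u t) x y.
Proof.
rewrite /edge !ffunE => /orP[yx|xy] tx ty; apply/orP; [left|right].
  by case: eqP yx tx => // -> yx; apply.
by case: eqP xy ty => // -> xy; apply.
Qed.

Definition same_pair (a b x y : 'I_n) :=
  ((x == a) && (y == b)) || ((x == b) && (y == a)).

Lemma dev_del_edge u v x y :
  edge s x y -> ~~ same_pair u v x y -> edge (deviate s u (s u :\ v)) x y.
Proof.
rewrite negb_or !negb_and => xy /andP[nuv nvu]; apply: dev_edge => // e wu.
  by move: nuv; rewrite e eqxx /= !inE wu andbT.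
by move: nvu; rewrite e eqxx orbF !inE wu andbT.
Qed.

Definition dsum u := \sum_w gd s u w.

Hypothesis irr : forall u, u \notin s u.
Hypothesis conn : forall u v, v \in ball s n u.
(** Integer forms of the equilibrium condition. Since [f] need only bound the new distances from
    above, no distance after a deviation is ever computed. In [del] at least one link is saved,
    hence more than [9 n]. *)
Hypothesis swap : forall u (t : {set 'I_n}) (f : 'I_n -> nat),
  u \notin t -> #|t| <= #|s u| ->
  (forall w, w \in ball (deviate s u t) (f w) u) -> dsum u <= \sum_w f w.
Hypothesis del : forall u (t : {set 'I_n}) (f : 'I_n -> nat),
  u \notin t -> #|t| < #|s u| ->
  (forall w, w \in ball (deviate s u t) (f w) u) ->
  dsum u + 9 * n < \sum_w f w.

Lemma edge_irr u : edge s u u = false.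
Proof. by rewrite /edge (negPf (irr u)). Qed.

(** If both ends paid for the edge, one of them could stop paying without changing the graph. *)
Lemma one_owner u v : v \in s u -> u \notin s v.
Proof.
move=> vu; apply/negP => uv.
have vNu : v != u by apply: contraTneq vu => ->.
have dE x y : edge s x y -> edge (deviate s u (s u :\ v)) x y.
  move=> xy; have [/orP[]/andP[/eqP -> /eqP ->]|xyNuv] := boolP (same_pair u v x y).
  - by rewrite /edge !ffunE (negPf vNu) uv orbT.
  - by rewrite /edge !ffunE (negPf vNu) uv.
  exact: dev_del_edge.
have := @del u (s u :\ v) (gd s u); rewrite !inE (negPf (irr u)) andbF.
rewrite [in #|s u|](cardsD1 v) vu ltnS leqnn => H.
suff: dsum u + 9 * n < dsum u by lia.
apply: H => // w; have /ballP[p [pp lp sp]] := gd_ball conn u w.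
by apply/ballP; exists p; split=> //; apply: sub_path pp.
Qed.

(** When [u] drops [v], only the vertices with a geodesic from [u] through [v] get farther. The
    detour to [v] followed by the rest of the geodesic costs each at most [L - 1] more, and [del]
    bounds the total from below. *)
Lemma detour u v L :
  v \in s u -> v \in ball (deviate s u (s u :\ v)) L u ->
  9 * n < #|[set w | gd s u w == (gd s v w).+1]| * L.-1.
Proof.
move=> vu vL; set B := [set w | _].
have := @del u (s u :\ v) (fun w => gd s u w + (w \in B) * L.-1).
rewrite !inE (negPf (irr u)) andbF [in #|s u|](cardsD1 v) vu ltnS leqnn.
rewrite big_split -big_distrl /= -/(dsum u).
have -> : \sum_(i < n) (i \in B) = #|B|.
  by rewrite -sum1_card [RHS]big_mkcond /=; apply: eq_bigr => i _; case: (i \in B).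
move=> H; suff: dsum u + 9 * n < dsum u + #|B| * L.-1 by rewrite ltn_add2l.
apply: H => // w; have [wB|wB] := boolP (w \in B).
  have /eqP dw : gd s u w == (gd s v w).+1 by rewrite inE in wB.
  apply: (@ball_le _ _ (L + gd s v w)); first by lia.
  by apply: ball_trans vL (dev_ball conn _ _); rewrite dw.
rewrite addn0; have [->|uw] := eqVneq w u; first by rewrite ball_refl.
rewrite eq_sym in uw; have [z uz dz] := gd_next conn uw.
rewrite dz -add1n; apply: ball_trans (dev_ball conn _ _); last by rewrite dz.
apply/ball_edge/dev_del_edge => //; apply/norP; split.
  by rewrite eqxx; apply: contraNneq wB => zv; rewrite inE -zv dz.
by apply/negP => /andP[_ /eqP zu]; rewrite zu edge_irr in uz.
Qed.

(** At most [n] vertices are affected, so [L - 1 > 9]: every cycle is long. *)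
Lemma long_detour u v L :
  v \in s u -> v \in ball (deviate s u (s u :\ v)) L u -> 10 < L.
Proof.
move=> vu vL; have := detour vu vL; set B := [set w | _] => lt9.
have := leq_trans lt9 (leq_mul (max_card (mem B)) (leqnn _)).
by rewrite card_ord mulnC ltn_mul2l => /andP[_]; lia.
Qed.

(** * The breadth-first tree at a vertex of least distance sum *)

Variable r : 'I_n.
Hypothesis rmin : forall u, dsum r <= dsum u.

Notation h := (gd s r).

(* Parent in the breadth-first tree, with the junk value [par r = r]. *)
Definition par v :=
  if v == r then r else odflt v [pick y | edge s v y & h v == (h y).+1].

Lemma par_root : par r = r.
Proof. by rewrite /par eqxx. Qed.

Lemma parP v : v != r -> edge s v (par v) /\ h v = (h (par v)).+1.
Proof.
move=> vr; rewrite /par (negPf vr); case: pickP => [y /andP[? /eqP]|] //=.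
have [z vz dz] := gd_next conn vr.
by move/(_ z); rewrite vz gd_sym dz (gd_sym s z) eqxx.
Qed.

Lemma h0 : h r = 0. Proof. exact: gd_refl. Qed.

Lemma h_gt0 v : (0 < h v) = (v != r).
Proof. by rewrite lt0n gd_eq0 // eq_sym. Qed.

Lemma h_edge x y : edge s x y -> h x <= (h y).+1.
Proof. by move=> xy; rewrite !(gd_sym s r) gd_edge. Qed.

(** No bound on [i] is required: truncated subtraction stops at 0 just as [par] stops at [r]. *)
Lemma h_iter i v : h (iter i par v) = h v - i.
Proof.
elim: i => [|i IHi] /=; first by rewrite subn0.
have [e|/parP[_]] := eqVneq (iter i par v) r; last first.
  by rewrite IHi => /(congr1 predn) /= <-; rewrite subnS.
by rewrite e par_root h0; move: IHi; rewrite e h0; lia.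
Qed.

Lemma iter_neq_root i v : i < h v -> iter i par v != r.
Proof. by move=> iv; rewrite -h_gt0 h_iter subn_gt0. Qed.

Lemma climb t u v k :
  (forall i, i < k -> edge (deviate s u t) (iter i par v) (iter i.+1 par v)) ->
  iter k par v \in ball (deviate s u t) k v.
Proof.
elim: k => [|k IHk] e; first exact: ball_refl.
rewrite -[X in ball _ X _]addn1; apply: ball_trans (ball_edge (e k _)) => //.
by apply: IHk => i ik; apply/e/ltnW.
Qed.

(** * Non-tree edges and their owners *)

Definition nontree u v := [&& v \in s u, par v != u & par u != v].
Definition special u := [exists v, nontree u v].

Lemma nontree_dev u v y : nontree u v -> y != r ->
  edge (deviate s u (s u :\ v)) y (par y).
Proof.
move=> /and3P[vu pv pu] yr; have [e _] := parP yr; apply: dev_del_edge => //.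
by apply/norP; split; apply/negP => /andP[/eqP -> /eqP e']; rewrite e' eqxx in pu pv.
Qed.

(** Climbing from [u] and [v] to a common ancestor gives a detour of length [i + k] around the
    edge. *)
Lemma nontree_meet u v i k : nontree u v ->
  i <= h u -> k <= h v -> iter i par u = iter k par v -> 10 < i + k.
Proof.
move=> uv iu kv e; have /and3P[vu _ _] := uv.
apply: (long_detour vu); apply: (@ball_trans _ _ _ _ _ (iter i par u)).
  apply: climb => j ji; apply: nontree_dev => //; apply: iter_neq_root.
  exact: leq_trans ji iu.
rewrite ball_sym e; apply: climb => j jk; apply: nontree_dev => //.
by apply: iter_neq_root; apply: leq_trans jk kv.
Qed.

Lemma iter_root v : iter (h v) par v = r.
Proof. by apply/eqP; rewrite eq_sym -(gd_eq0 conn) h_iter subnn. Qed.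

Lemma nontree_h u v : nontree u v -> h v <= (h u).+1.
Proof. by case/and3P=> vu _ _; apply: h_edge; rewrite /edge vu orbT. Qed.

(** The two climbs meet at [r] at the latest, so [10 < h u + h v <= 2 h u + 1]. *)
Lemma nontree_deep u v : nontree u v -> 4 < h u.
Proof.
move=> uv; have := nontree_meet uv (leqnn _) (leqnn _).
by rewrite !iter_root => /(_ erefl); have := nontree_h uv; lia.
Qed.

(** Comparing levels, a common vertex would force [k <= i + 1], hence [i + k <= 9], against
    [nontree_meet]. *)
Lemma nontree_clean u v i k : nontree u v -> i <= 4 ->
  iter k par v != iter i par u.
Proof.
move=> uv i4; have deep := nontree_deep uv; have hv := nontree_h uv.
apply/eqP => e; have := congr1 (gd s r) e; rewrite !h_iter => he.
have iu : i <= h u by lia.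
have kv : k <= h v by lia.
by have := nontree_meet uv iu kv (esym e); lia.
Qed.

(** Each owner of a non-tree edge with its first three ancestors. *)
Definition chain_set := [set z | [exists u, special u &&
  [exists i : 'I_4, iter i par u == z]]].

Lemma chain_setP z : reflect
  (exists u v i, [/\ nontree u v, i <= 3 & iter i par u = z]) (z \in chain_set).
Proof.
rewrite inE; apply: (iffP existsP) => [[u /andP[/existsP[v uv] /existsP[i /eqP e]]]|].
  by exists u, v, i; split=> //; rewrite -ltnS.
case=> u [v [i [uv i3 e]]]; exists u; apply/andP; split; first by apply/existsP; exists v.
by apply/existsP; exists (inord i); rewrite inordK // e.
Qed.

(* The targets of [x] that are not children of [x], or that are children at most
   three levels above (or equal to) the owner of a non-tree edge. *)
Definition costly x := [set z in s x | (par z != x) || (z \in chain_set)].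

(** * Trading all costly links for one link to the root *)

Section CostlyDeviation.
Variable x : 'I_n.
(** Removing [x] from [[set r]] keeps the strategy valid when [x = r]. *)
Let G' := deviate s x ((s x :\: costly x) :|: ([set r] :\ x)).

Let tree_step w : w != r -> w != x -> ~~ ((w \in costly x) && (par w == x)) ->
  edge G' (par w) w.
Proof.
move=> wr wx cw; have [e _] := parP wr.
apply: dev_edge => [|pw wsx|/eqP]; first by rewrite edge_sym.
  by move: cw; rewrite pw eqxx andbT => cw; rewrite !inE in cw *; rewrite wsx in cw *; rewrite cw.
by rewrite (negPf wx).
Qed.

(* If the tree path from [w] up to [r] uses no deleted downward edge, then it
   ends in [r], now adjacent to [x], or in [x] itself. *)
Let clean_ball w : (forall k, ~~ ((iter k par w \in costly x) && (par (iter k par w) == x))) ->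
  w \in ball G' (h w).+1 x.
Proof.
move: {2}(h w) (erefl (h w)) => m; elim: m w => [|m IHm] w hw cw.
  have /eqP -> : w == r by rewrite eq_sym -(gd_eq0 conn) hw.
  rewrite h0; have [->|rx] := eqVneq r x; first exact: ball_refl.
  by apply: ball_edge; rewrite /G' /edge !ffunE eqxx !inE rx eqxx orbT.
have [->|wx] := eqVneq w x; first exact: ball_refl.
have wr : w != r by rewrite -h_gt0 hw.
have [_ hp] := parP wr; rewrite hp -addn1.
apply: (@ball_trans _ _ _ _ _ (par w)).
  by apply: IHm => [|k]; [lia|rewrite -iterSr; apply: cw].
by apply/ball_edge/tree_step => //; apply: (cw 0).
Qed.

(* The subtree below a deleted edge [x z] is reached by climbing from the owner
   [u] of a non-tree edge [u v], at most three levels below [z]. *)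
Let costly_ball z : z \in costly x -> par z = x -> z \in ball G' (h z + 9) x.
Proof.
move=> zx pz; have zsx : z \in s x by move: zx; rewrite inE => /andP[].
have zr : z != r.
  by apply: contraTneq zsx => zr; rewrite -pz zr par_root (negPf (irr r)).
have [_ hz] := parP zr; rewrite pz in hz.
have /chain_setP[u [v [i [uv i3 iz]]]] : z \in chain_set.
  by move: zx; rewrite inE pz eqxx => /andP[].
(* The tree path from [v] misses [x], which is the ancestor of [u] at height [i + 1 <= 4], so it
   uses no deleted downward edge. *)
have vG : v \in ball G' (h v).+1 x.
  apply: clean_ball => k; apply/negP => /andP[_ /eqP pk].
  have /eqP[] := @nontree_clean u v i.+1 k.+1 uv (i3 : i.+1 <= 4).
  by rewrite !iterS pk iz.
have hv := nontree_h uv; have hu := nontree_deep uv.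
have hzu : h z = h u - i by rewrite -iz h_iter.
have hx : h u = (h x + i).+1 by lia.
have uG : u \in ball G' 1 v.
  apply/ball_edge; have /and3P[vu _ _] := uv; apply: dev_edge.
  - by rewrite /edge vu orbT.
  - by move=> <-; rewrite (negPf (one_owner vu)).
  - by move=> ux; move: hx; rewrite ux; clear; lia.
(* The source of the 9: with [h v <= h u + 1], [h u = h z + i] and [i <= 3], the length is at most
   [h z + 2 i + 3]. *)
apply: (@ball_le _ _ ((h v).+1 + 1 + i)); first by lia.
apply: ball_trans (ball_trans vG uG) _; rewrite -iz; apply: climb => j ji.
have [|e _] := @parP (iter j par u); first by apply: iter_neq_root; lia.
apply: dev_edge => // ex; have := congr1 (gd s r) ex.
  by rewrite h_iter hx; clear -ji; lia.
by rewrite h_iter hx; clear -ji; lia.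
Qed.

(** Descend the tree from [r]; [costly_ball] takes over wherever a deleted downward edge is met. *)
Lemma costly_dev_ball w : w \in ball G' (h w + 9) x.
Proof.
move: {2}(h w) (erefl (h w)) => m; elim: m w => [|m IHm] w hw.
  have /eqP -> : w == r by rewrite eq_sym -(gd_eq0 conn) hw.
  apply: (@ball_le _ _ (h r).+1); first by lia.
  apply: clean_ball => k; rewrite iter_fix ?par_root //.
  apply/negP => /andP[]; rewrite inE => /andP[rsx _] /eqP rx.
  by have := irr x; rewrite -{1}rx rsx.
have [->|wx] := eqVneq w x; first exact: ball_refl.
have wr : w != r by rewrite -h_gt0 hw.
have [/andP[cw /eqP pw]|cw] := boolP ((w \in costly x) && (par w == x)).
  exact: costly_ball.
have [_ hp] := parP wr; rewrite hp addSn -addn1.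
apply: (@ball_trans _ _ _ _ _ (par w)); first by apply: IHm; lia.
exact/ball_edge/tree_step.
Qed.

(** Giving up two costly links for one to [r] would leave a distance sum of at most
    [dsum r + 9 n <= dsum x + 9 n], against [del]. *)
Lemma card_costly : #|costly x| <= 1.
Proof.
rewrite leqNgt; apply/negP => c2.
have sub : costly x \subset s x by apply/subsetP => z; rewrite inE => /andP[].
have lt_t : #|(s x :\: costly x) :|: ([set r] :\ x)| < #|s x|.
  have le1 : #|[set r] :\ x| <= 1.
    by rewrite -(cards1 r) subset_leq_card ?subsetDl.
  have leU := (leq_card_setU (s x :\: costly x) ([set r] :\ x)).1.
  apply: leq_ltn_trans leU _; rewrite -(cardsID (costly x) (s x)) (setIidPr sub).
  by rewrite addnC ltn_add2r (leq_ltn_trans le1).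
have := @del x _ (fun w => h w + 9) _ lt_t costly_dev_ball.
rewrite big_split /= sum_nat_const card_ord -/(dsum r).
rewrite !inE eqxx (negPf (irr x)) andbF /= => /(_ isT).
by have := rmin x; lia.
Qed.

Lemma costly_inj a b : a \in costly x -> b \in costly x -> a = b.
Proof. by move=> ax bx; apply: (card_le1_eqP card_costly). Qed.

End CostlyDeviation.

(** * Disjoint chains above the owners *)

Lemma nontree_costly u v : nontree u v -> v \in costly u.
Proof. by case/and3P=> vu pv _; rewrite inE vu pv. Qed.

Lemma nontree_inj u v w : nontree u v -> nontree u w -> v = w.
Proof. by move=> /nontree_costly uv /nontree_costly; apply: costly_inj. Qed.

Lemma h_par_iter u v i : nontree u v -> i <= 3 ->
  h (iter i par u) = (h (iter i.+1 par u)).+1.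
Proof. by move=> /nontree_deep deep i3; rewrite !h_iter; lia. Qed.

(** A chain vertex already owns one costly link, the non-tree edge or the chain edge below it. Its
    edge to its parent would be a second one, so the parent owns that edge. *)
Lemma chain_owned u v i : nontree u v -> i <= 3 ->
  iter i par u \in s (iter i.+1 par u).
Proof.
move=> uv; have deep := nontree_deep uv; elim: i => [|i IHi] i3.
  have hp := h_par_iter uv i3; rewrite /= in hp *.
  have [|] := @parP u; first by rewrite -h_gt0; lia.
  rewrite /edge => /orP[pu|//] _; have /and3P[_ _ /eqP[]] := uv.
  apply: (@costly_inj u); last exact: nontree_costly uv.
  rewrite inE pu; apply/orP; left; apply: contra_eqN hp => /eqP e.
  have [|_ ->] := @parP (par u); last by rewrite e; lia.
  by rewrite -h_gt0 (h_iter 1); lia.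
set y := iter i.+1 par u.
have hp : h y = (h (par y)).+1 := h_par_iter uv i3.
have hq : h (iter i par u) = (h y).+1 := h_par_iter uv (ltnW i3).
have [|] := @parP y; first by rewrite -h_gt0 hp.
rewrite /edge => /orP[py|//] _; exfalso.
have e : par y = iter i par u; last by rewrite e in hp; lia.
apply: (@costly_inj y).
  rewrite inE py; apply/orP; left; apply: contra_eqN hp => /eqP e.
  by have := h_iter 2 y; rewrite /= e => e2; have := h_iter 1 y => /= ->; lia.
rewrite inE (IHi (ltnW i3)) /=; apply/orP; right.
by apply/chain_setP; exists u, v, i; split=> //; apply: ltnW.
Qed.

Lemma chain_costly u v i : nontree u v -> i <= 3 ->
  iter i par u \in costly (iter i.+1 par u).
Proof.
move=> uv i3; rewrite inE (chain_owned uv) //; apply/orP; right.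
by apply/chain_setP; exists u, v, i.
Qed.

(** The unique costly link of a chain vertex leads to the next one below, so chains through a common
    vertex agree downwards. They end together, since only at the owner is that link a non-tree
    edge. *)
Lemma chain_inj u v u' v' i j : nontree u v -> nontree u' v' -> i <= 3 -> j <= 3 ->
  iter i par u = iter j par u' -> u = u' /\ i = j.
Proof.
move=> uv uv'; elim: i j => [|i IHi] [|j] //= i3 j3 e.
- have := chain_costly uv' (ltnW j3); rewrite iterS -e.
  move/(costly_inj (nontree_costly uv)) => ev.
  by have /and3P[_ /eqP[]] := uv; rewrite ev.
- have := chain_costly uv (ltnW i3); rewrite iterS e.
  move/(costly_inj (nontree_costly uv')) => ev.
  by have /and3P[_ /eqP[]] := uv'; rewrite ev.
have c := chain_costly uv (ltnW i3).
have c' := chain_costly uv' (ltnW j3); rewrite !iterS -e -iterS in c'.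
have [||-> ->] // := IHi j _ _ (costly_inj c c'); exact: ltnW.
Qed.

(** * Two-edge-connected components *)

Definition edge_minus a b : rel 'I_n :=
  fun x y => edge s x y && ~~ same_pair a b x y.

(* Being in the same 2-edge-connected component; if [ab] is not an edge, the
   condition only says that [x] and [y] are connected. *)
Definition biconn x y := [forall a, forall b, connect (edge_minus a b) x y].

Lemma edge_minus_sym a b : symmetric (edge_minus a b).
Proof.
move=> x y; rewrite /edge_minus /same_pair edge_sym; congr (_ && ~~ _).
by rewrite orbC; congr (_ || _); rewrite andbC.
Qed.

Lemma connect_minus_sym a b : connect_sym (edge_minus a b).
Proof. exact/sym_connect_sym/edge_minus_sym. Qed.

Lemma biconnP x y : reflect (forall a b, connect (edge_minus a b) x y) (biconn x y).
Proof.
by apply: (iffP forallP) => [H a b|H a]; [have /forallP := H a|apply/forallP].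
Qed.

Lemma biconn_refl x : biconn x x.
Proof. exact/biconnP. Qed.

Lemma biconn_sym x y : biconn x y = biconn y x.
Proof.
by apply: eq_forallb => a; apply: eq_forallb => b; apply: connect_minus_sym.
Qed.

Lemma biconn_trans x y z : biconn x y -> biconn y z -> biconn x z.
Proof.
move=> /biconnP xy /biconnP yz; apply/biconnP => a b.
exact: connect_trans (xy a b) (yz a b).
Qed.

Lemma biconn_edge x y : edge s x y -> connect (edge_minus x y) x y -> biconn x y.
Proof.
move=> xy c; apply/biconnP => a b.
have [ab|ab] := boolP (same_pair a b x y); last by rewrite connect1 // /edge_minus xy.
rewrite (eq_connect (e' := edge_minus x y)) // => p q; congr (_ && ~~ _).
by case/orP: ab => /andP[/eqP -> /eqP ->]; rewrite /same_pair // orbC.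
Qed.

Lemma path_minus x p a b : path (edge s) x p -> a \notin x :: p ->
  path (edge_minus a b) x p.
Proof.
elim: p x => //= z p IHp x /andP[xz pp]; rewrite !inE !negb_or => /and3P[ax az ap].
rewrite IHp ?inE ?negb_or ?az // andbT /edge_minus xz /same_pair.
by rewrite ![_ == a]eq_sym (negPf ax) (negPf az) andbF.
Qed.

(** The first edge [xz] can be bypassed: go from [x] to the end of the path without [xz], then back
    along [p], which avoids [x]. *)
Lemma biconn_path x p : path (edge s) x p -> uniq (x :: p) ->
  biconn x (last x p) -> forall y, y \in p -> biconn x y.
Proof.
elim: p x => //= z p IHp x /andP[xz pp] /andP[xp up] bx.
have bxz : biconn x z.
  apply: biconn_edge => //; move/biconnP: bx => /(_ x z) /connect_trans; apply.
  by rewrite connect_minus_sym; apply/connectP; exists p => //; apply: path_minus.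
move=> y; rewrite inE => /orP[/eqP -> //|yp].
apply: (biconn_trans bxz); apply: IHp yp => //.
by apply: biconn_trans bx; rewrite biconn_sym.
Qed.

Lemma tree_connect a b y :
  (forall k, iter k par y != r ->
     ~~ same_pair a b (iter k par y) (iter k.+1 par y)) ->
  connect (edge_minus a b) y r.
Proof.
move: {2}(h y) (erefl (h y)) => m; elim: m y => [|m IHm] y hy c.
  have /eqP -> : y == r by rewrite eq_sym -(gd_eq0 conn) hy.
  exact: connect0.
have yr : y != r by rewrite -h_gt0 hy.
have [e hp] := parP yr; apply: (@connect_trans _ _ (par y)).
  by apply: connect1; rewrite /edge_minus e; apply: (c 0).
by apply: IHm => [|k]; [lia|rewrite -!iterSr; apply: c].
Qed.

Lemma nontree_biconn u v : nontree u v -> biconn u v.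
Proof.
move=> uv; have /and3P[vu pv pu] := uv.
have c y : connect (edge_minus u v) y r.
  apply: tree_connect => k _; apply/norP; split.
    by apply/negP => /andP[/eqP e]; rewrite iterS e (negPf pu).
  by apply/negP => /andP[/eqP e]; rewrite iterS e (negPf pv).
apply: biconn_edge; first by rewrite /edge vu.
by apply: connect_trans (c u) _; rewrite connect_minus_sym.
Qed.

(** The edge from [x] to its parent lies on a cycle: from [x] to [u], across to [v], up to [r] by a
    tree path missing [x], and down to [par x]. *)
Lemma chain_biconn u v i : nontree u v -> i <= 4 -> biconn u (iter i par u).
Proof.
move=> uv; elim: i => [|i IHi] i4; first exact: biconn_refl.
have bx := IHi (ltnW i4); apply: (biconn_trans bx); rewrite iterS.
have deep := nontree_deep uv; have cl := nontree_clean _ uv (ltnW i4).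
set x := iter i par u in bx cl *.
have xr : x != r by rewrite -h_gt0 h_iter; lia.
have [e hx] := parP xr; apply: biconn_edge => //.
move: bx; rewrite biconn_sym => /biconnP/(_ x (par x)) /connect_trans; apply.
have /biconnP/(_ x (par x)) /connect_trans := nontree_biconn uv; apply.
apply: (@connect_trans _ _ r).
  apply: tree_connect => k _; rewrite /same_pair (negPf (cl k)).
  by have /negPf := cl k.+1 => ->; rewrite andbF.
rewrite connect_minus_sym; apply: tree_connect => k _.
have nx j : iter j par (par x) != x.
  by apply/eqP => /(congr1 (gd s r)); rewrite h_iter; lia.
by rewrite /same_pair (negPf (nx k)); have /negPf -> := nx k.+1; rewrite andbF.
Qed.

(** * Degrees and pockets in a block; no non-tree edge exists *)

Section Block.
Variables x0 v0 : 'I_n.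
Hypothesis x0v0 : nontree x0 v0.

Definition block := [set y | biconn x0 y].
Definition nbrs v := [set y in block | edge s v y].
Definition specials := [set u in block | special u].

Lemma block_biconn u (uH : u \in block) v : (v \in block) = biconn u v.
Proof.
move: uH; rewrite !inE => u0; apply/idP/idP; last exact: biconn_trans.
by apply: biconn_trans; rewrite biconn_sym.
Qed.

(** Without the edge [vz], some simple path still leads from [v] to another block vertex; it stays
    in the block, and its first step is not [z]. *)
Lemma block_nbr v z : v \in block -> exists2 w, w \in nbrs v & w != z.
Proof.
move=> vH; have [y yH yv] : exists2 y, y \in block & y != v.
  have [e|] := eqVneq x0 v; last by exists x0; rewrite // inE biconn_refl.
  exists v0; first by rewrite inE nontree_biconn.
  by have /and3P[vu _ _] := x0v0; apply: contraTneq vu => ->; rewrite e irr.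
have b : biconn v y by rewrite -(block_biconn vH).
have /biconnP/(_ v z)/connectP[p pp lp] := b; subst y.
case/shortenP: pp b yv {yH} => -[|w q] pq uq _ b; first by rewrite eqxx.
move=> _; exists w; last first.
  by move: pq => /= /andP[/andP[_]]; rewrite /same_pair eqxx /= negb_or => /andP[].
have pq' : path (edge s) v (w :: q) by apply: sub_path pq => x y /andP[].
have := biconn_path pq' uq b; move=> /(_ w (mem_head _ _)) vw.
by rewrite inE (block_biconn vH) vw; move: pq' => /= /andP[].
Qed.

Lemma card_nbrs v : v \in block -> 1 < #|nbrs v|.
Proof.
move=> vH; have [w1 w1v _] := block_nbr v vH; have [w2 w2v w21] := block_nbr w1 vH.
by apply/card_gt1P; exists w1, w2; rewrite // eq_sym.
Qed.

(** Block edges are tree edges, at most one per child, or non-tree edges, at most one per owner;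
    each is counted from both ends. *)
Lemma sum_nbrs : \sum_(v in block) #|nbrs v| <= 2 * #|block| + 2 * #|specials|.
Proof.
pose cnt (P : rel 'I_n) := \sum_(v in block) \sum_(y in block) P v y.
have cnt_flip P : cnt (fun v y => P y v) = cnt P by rewrite /cnt exchange_big.
have ltree : cnt (fun v y => par v == y) <= #|block|.
  rewrite -sum1_card; apply: leq_sum => v _; apply: sum_pred_le1 => a b _ _.
  by move=> /eqP <- /eqP.
have lnontree : cnt nontree <= #|specials|.
  rewrite -sum1_card (eq_bigl (fun v => (v \in block) && special v)); last first.
    by move=> v; rewrite !inE.
  rewrite big_mkcondr; apply: leq_sum => v vH; case: ifPn => sv.
    by apply: sum_pred_le1 => a b _ _; apply: nontree_inj.
  rewrite big1 // => y _; apply/eqP; rewrite eqb0.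
  by apply: contra sv => vy; apply/existsP; exists y.
apply: leq_trans (_ : cnt (fun v y => par v == y) + cnt (fun v y => par y == v)
   + (cnt nontree + cnt (fun v y => nontree y v)) <= _).
  rewrite /cnt -!big_split; apply: leq_sum => v vH; rewrite -!big_split /=.
  rewrite -sum1_card (eq_bigl (fun y => (y \in block) && edge s v y)); last first.
    by move=> y; rewrite !inE.
  rewrite big_mkcondr; apply: leq_sum => y _; case: ifP => //.
  rewrite /nontree /edge; case: (par v == y) => //; case: (par y == v) => //=.
  by case/orP=> ->; rewrite ?addn1 //= ltnS.
by rewrite (cnt_flip (fun v y => par v == y)) (cnt_flip nontree) !mul2n -!addnn; lia.
Qed.

Definition branching := [set v in block | 2 < #|nbrs v|].

(** All degrees in the block are at least two, so [sum_nbrs] bounds the total excess. *)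
Lemma card_branching : #|branching| <= 2 * #|specials|.
Proof.
suff : 2 * #|block| + #|branching| <= \sum_(v in block) #|nbrs v|.
  by have := sum_nbrs; lia.
rewrite mulnC -sum_nat_const -[X in _ + X]sum1_card.
rewrite [X in _ + X](eq_bigl (fun v => (v \in block) && (2 < #|nbrs v|))); last first.
  by move=> v; rewrite !inE.
rewrite [X in _ + X]big_mkcondr -big_split; apply: leq_sum => v vH /=.
by have := card_nbrs vH; case: ifP.
Qed.

Definition good := [set v in block | (#|nbrs v| == 2) && [exists u in block, v \in s u]].
Definition down := [set v in block | (par v \in block) && (v \in s (par v))].

Lemma block_par u v i : nontree u v -> u \in block -> i <= 4 -> iter i par u \in block.
Proof. by move=> uv uH i4; rewrite (block_biconn uH) (chain_biconn uv). Qed.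

(** Each special vertex contributes a chain of four vertices to [down], and the chains are
    disjoint. *)
Lemma card_down : 4 * #|specials| + #|down :\: chain_set| <= #|down|.
Proof.
rewrite -(cardsID chain_set down) leq_add2r.
pose f (p : 'I_n * 'I_4) := iter p.2 par p.1.
have -> : 4 * #|specials| = #|f @: setX specials setT|.
  rewrite card_in_imset ?cardsX ?cardsT ?card_ord 1?mulnC //.
  move=> [u i] [u' j]; rewrite !inE /f /= !andbT.
  move=> /andP[_ /existsP[v uv]] /andP[_ /existsP[v' uv']] e.
  have [||-> /val_inj ->] // := chain_inj uv uv' _ _ e; by rewrite -ltnS.
apply/subset_leq_card/subsetP => z /imsetP[[u i]].
rewrite in_setX inE => /andP[/andP[uH /existsP[v uv]] _] ->.
have i3 : i <= 3 by rewrite -ltnS.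
rewrite in_setI inE (block_par uv uH) ?(leqW i3) //=.
rewrite -iterS (block_par uv uH) // (chain_owned uv) //=.
by apply/chain_setP; exists u, v, i.
Qed.

(** A block vertex neither branching nor good owns both its block links. One of them is not costly,
    so it leads to a child outside [chain_set]. *)
Lemma card_block : #|block| <= 2 * #|good|.
Proof.
have dn : #|down| <= #|branching| + #|good|.
  apply: leq_trans (leq_card_setU _ _); apply/subset_leq_card/subsetP => v.
  rewrite !inE => /and3P[vH pH vp]; rewrite vH /=.
  have := card_nbrs (v := v); rewrite inE vH => /(_ isT) n2.
  have [//|n3] := ltnP 2; rewrite eqn_leq n3 n2 /=.
  by apply/existsP; exists (par v); rewrite inE pH.
have sub : block \subset (branching :|: good) :|: par @: (down :\: chain_set).
  apply/subsetP => v vH; rewrite in_setU; apply/orP.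
  have n2 := card_nbrs vH.
  have [|vNbg] := boolP (v \in branching :|: good); [by left|right].
  move: vNbg; rewrite !in_setU negb_or ![v \in [set _ in _ | _]]inE vH /= -leqNgt.
  move=> /andP[n3]; rewrite eqn_leq n3 n2 /= => /existsPn no_in.
  have nb y : y \in nbrs v -> [/\ y \in block, y \in s v & v \notin s y].
    rewrite inE => /andP[yH /orP[yv|vy]]; first by split=> //; apply: one_owner.
    by have := no_in y; rewrite yH vy.
  have [c cv cN] : exists2 c, c \in nbrs v & c \notin costly v.
    have /card_gt1P[a [b [an bn ab]]] := n2.
    have [ac|] := boolP (a \in costly v); last by exists a.
    exists b => //; apply: contra ab => bc; apply/eqP; exact: costly_inj bc.
  have [cH csv _] := nb _ cv; move: cN; rewrite inE csv /= negb_or negbK.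
  move=> /andP[/eqP pc cC]; apply/imsetP; exists c; rewrite // in_setD cC inE cH.
  by rewrite pc vH csv.
(* With [b], [g], [p] the numbers of branching, good and special vertices,
   [|block| <= b + g + (b + g - 4 p)] and [b <= 2 p]. *)
have := subset_leq_card sub; have := card_branching; have := card_down.
have := leq_imset_card par (down :\: chain_set).
have := (leq_card_setU (branching :|: good) (par @: (down :\: chain_set))).1.
have := (leq_card_setU branching good).1.
by move: dn; move: #|_| #|_| #|_|; lia.
Qed.

(* The vertices that hang off the block at [v]. *)
Definition pocket v := [set w | [forall y in block, (y != v) ==> (gd s v w < gd s y w)]].

(** A vertex has at most one strictly nearest block vertex, so pockets are disjoint. *)
Lemma sum_pocket : \sum_(v in good) #|pocket v| <= n.
Proof.
apply: (@leq_trans (\sum_(v in good) \sum_w (w \in pocket v))).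
  by apply: leq_sum => v _; rewrite -sum1_card big_mkcond; apply: leq_sum => w _; case: ifP.
rewrite exchange_big /= -[X in _ <= X]card_ord -sum1_card; apply: leq_sum => w _.
apply: sum_pred_le1 => a b; rewrite !inE => /andP[aH _] /andP[bH _].
move=> /forall_inP pa /forall_inP pb; apply/eqP; apply: contraT => ab.
have := pa b; have := pb a; rewrite !inE aH bH ab eq_sym ab /=.
by move=> /(_ isT) + /(_ isT); lia.
Qed.

Lemma nonbiconn_cut x y : edge s x y -> ~~ biconn x y -> ~~ connect (edge_minus x y) x y.
Proof. by move=> xy; apply: contra; apply: biconn_edge. Qed.

(** The edge [vz] is a bridge. If some other block vertex [y] were no farther from [w], geodesics
    from [y] and from [z] to [w] would both miss [v] and join [v] to [z] around the bridge. *)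
Lemma pocketP v z w : v \in block -> edge s v z -> z \notin block ->
  gd s v w = (gd s z w).+1 -> w \in pocket v.
Proof.
move=> vH vz zH dw; rewrite inE; apply/forall_inP => y yH; apply/implyP => yv.
rewrite ltnNge; apply/negP => le_yv.
have cut := nonbiconn_cut vz; rewrite -(block_biconn vH) in cut.
have /negP[] := cut zH.
have [p [pp lp _ gp]] := gd_path conn y w.
have [q [pq lq _ gq]] := gd_path conn z w.
have vp : v \notin y :: p.
  apply/negP => /gp e; move: yv; rewrite -(gd_eq0 conn) -lt0n.
  by clear -e le_yv; lia.
have vq : v \notin z :: q by apply/negP => /gq e; clear -e dw; lia.
have /biconnP : biconn v y by rewrite -(block_biconn vH).
move=> /(_ v z) /connect_trans; apply; apply: (@connect_trans _ _ w).
  by apply/connectP; exists p => //; apply: path_minus.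
rewrite connect_minus_sym; apply/connectP; exists q => //; exact: path_minus.
Qed.

(* [B] is the set of vertices that [u] can reach by a geodesic through [v]. *)
Lemma good_bound v : v \in good -> 9 * n < 2 * #|pocket v| * (#|block| - 2).
Proof.
rewrite inE => /and3P[vH /eqP n2 /exists_inP[u uH vu]].
set B := [set w | gd s u w == (gd s v w).+1].
have uv : edge s u v by rewrite /edge vu.
have uNv : u != v by apply: contraTneq vu => ->.
have un : u \in nbrs v by rewrite inE uH edge_sym.
have [v' [v'u v'H vv' nbE]] : exists v',
    [/\ v' != u, v' \in block, edge s v v' & forall y, y \in nbrs v -> y = u \/ y = v'].
  have [v' v'n v'u] := block_nbr u vH; have := v'n; rewrite inE => /andP[v'H vv'].
  exists v'; split=> // y yn; have [->|yu] := eqVneq y u; [by left|right].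
  apply/eqP; apply: contraT => yv'; suff : 2 < #|nbrs v| by rewrite n2.
  apply/card_gt2P; exists u, v', y; split=> //; split=> //.
  by rewrite eq_sym. by rewrite eq_sym.
have v'v : v' != v by apply: contraTneq vv' => ->; rewrite edge_irr.
have leB : #|B| <= 2 * #|pocket v|.
  pose t := v' |: (s u :\ v).
  (* After the swap of [v] for [v'], pocket vertices in [B] get one farther. The rest of [B] gets
     one nearer, as geodesics from [v] to it may continue through [v']. *)
  pose f w := gd s u w + (w \in B :&: pocket v) - (w \in B :\: pocket v).
  have gt0 w : w \in B -> gd s u w = (gd s v w).+1 by rewrite inE => /eqP.
  have ut : u \notin t by rewrite !inE eq_sym (negPf v'u) (negPf (irr u)) andbF.
  have lt : #|t| <= #|s u|.
    by rewrite cardsU1 (cardsD1 v (s u)) vu leq_add2r leq_b1.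
  have uv'1 : v' \in ball (deviate s u t) 1 u.
    by apply: ball_edge; rewrite /edge !ffunE eqxx !inE eqxx.
  have sumf : \sum_w f w + #|B :\: pocket v| = dsum u + #|B :&: pocket v|.
    rewrite -!sum1_card [X in _ + X = _]big_mkcond [X in _ = _ + X]big_mkcond.
    rewrite -!big_split; apply: eq_bigr => w _ /=; rewrite /f !in_setI !in_setD.
    have := gt0 w; case: (w \in B) => [/(_ isT) ->|_]; last by rewrite !andbF /= !addn0 subn0.
    by case: (w \in pocket v) => /=; rewrite ?addn0 ?subn0 // subn1 addn1.
  have subP : #|B :&: pocket v| <= #|pocket v| by rewrite subset_leq_card ?subsetIr.
  suff : dsum u <= \sum_w f w.
    by rewrite -(cardsID (pocket v) B); clear -sumf subP; lia.
  apply: (swap ut lt) => w; rewrite /f in_setI in_setD.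
  have := gt0 w; have [wB|wB _] := boolP (w \in B) => /=.
    move/(_ isT) => dw; have [wP|wP] := boolP (w \in pocket v).
      rewrite subn0 dw -[_ + true]/((gd s v w).+1 + 1) addn1 -add2n.
      apply: ball_trans (_ : v \in _) (dev_ball conn _ _); last by rewrite dw.
      apply: (ball_trans uv'1); apply: ball_edge; apply: dev_edge => [|/eqP|/eqP].
      - by rewrite edge_sym.
      - by rewrite (negPf v'u).
      - by rewrite eq_sym (negPf uNv).
    have wv : v != w.
      apply: contraNneq wP => <-; rewrite inE; apply/forall_inP => y _.
      by apply/implyP; rewrite gd_refl lt0n gd_eq0.
    have [z vz dz] := gd_next conn wv.
    have zH : z \in block by apply: contraR wP => zH; apply: pocketP vz zH dz.
    have [|zu|zv'] := nbE z; first by rewrite inE zH.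
      by rewrite zu dw in dz; clear -dz; lia.
    rewrite dw addn0 subn1 /= dz zv' -add1n.
    by apply: ball_trans uv'1 (dev_ball conn _ _); rewrite dw dz zv'; clear; lia.
  rewrite addn0 andbF subn0; have [->|uw] := eqVneq w u; first by rewrite ball_refl.
  rewrite eq_sym in uw; have [z uz dz] := gd_next conn uw.
  rewrite dz -add1n; apply: ball_trans (dev_ball conn _ _); last by rewrite dz.
  apply/ball_edge/dev_edge => // [_ zu|zu].
    rewrite !inE zu andbT; apply/orP; right.
    by apply: contraNneq wB => zv; rewrite inE -zv dz.
  by rewrite zu edge_irr in uz.
have [p [pp lp up]] : exists p, [/\ path (edge_minus u v) u p, last u p = v & uniq (u :: p)].
  have : biconn u v by rewrite -(block_biconn uH).
  move=> /biconnP/(_ u v)/connectP[p pp lp]; move: lp.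
  by case/shortenP: pp => q pq uq _ lq; exists q.
have pp' : path (edge s) u p by apply: sub_path pp => x y /andP[].
have pH : {subset u :: p <= block}.
  move=> y; rewrite inE => /orP[/eqP -> //|]; rewrite (block_biconn uH).
  by apply: biconn_path; rewrite // lp -(block_biconn uH).
(* A simple path inside the block is a detour with at most [|block| - 1] edges. *)
have sp : size p <= #|block|.-1.
  suff : size (u :: p) <= #|block| by rewrite /=; clear; lia.
  by rewrite -(card_uniqP up); apply/subset_leq_card/subsetP.
have vL : v \in ball (deviate s u (s u :\ v)) (size p) u.
  apply/ballP; exists p; split=> //; apply: sub_path pp => x y /andP[].
  exact: dev_del_edge.
apply: leq_trans (detour vu vL) (leq_mul leB _).
by clear -sp; lia.
Qed.

(** Summing [good_bound] gives [|good| (9 n + 1) <= 2 n (|block| - 2) <= 4 n |good|], impossible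
    since [|good| > 0]. *)
Lemma no_block : False.
Proof.
have : \sum_(v in good) (9 * n).+1 <= \sum_(v in good) 2 * #|pocket v| * (#|block| - 2).
  by apply: leq_sum => v vg; apply: good_bound.
rewrite -big_distrl -big_distrr /= sum_nat_const.
have le_good := card_block; have le_pocket := sum_pocket.
have : 0 < #|block| by apply/card_gt0P; exists x0; rewrite inE biconn_refl.
move: (\sum_(v in good) _) #|good| #|block| le_pocket le_good => P G N lP lN N0 lG.
have := leq_trans lG (leq_mul (leq_mul (leqnn 2) lP) (leq_trans (leq_subr 2 N) lN)).
clear -lN N0; nia.
Qed.

End Block.

(** * Tree equilibria: links, centroid and depth *)

Lemma tree_edge u v : edge s u v -> par u = v \/ par v = u.
Proof.
have imp x y : y \in s x -> par x = y \/ par y = x.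
  move=> yx; have := @no_block x y; rewrite /nontree yx /=.
  have [->|] := eqVneq (par y) x; first by right.
  by have [->|_ _ /(_ isT)[]] := eqVneq (par x) y; first by left.
by case/orP=> /imp[]; [left|right|right|left].
Qed.

Lemma sum_neq_root : \sum_(u | u != r) 1 = n.-1.
Proof. by rewrite sum1_card cardC1 card_ord. Qed.

Lemma sum_bought : \sum_u #|s u| <= 2 * n.-1.
Proof.
pose up v y := (v != r) && (par v == y).
have le_up : \sum_v \sum_y up v y <= n.-1.
  rewrite -sum_neq_root [X in _ <= X]big_mkcond; apply: leq_sum => v _; rewrite /up.
  case: ifP => _; last by rewrite big1.
  rewrite (eq_bigl (fun y => y \in setT)); last by move=> y; rewrite inE.
  by apply: sum_pred_le1 => x y _ _ /= /eqP <- /eqP.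
apply: (@leq_trans (\sum_v \sum_y up v y + \sum_v \sum_y up y v)).
  rewrite -big_split; apply: leq_sum => v _; rewrite -big_split /= -sum1_card.
  rewrite big_mkcond; apply: leq_sum => y _; case: ifP => // yv.
  have vNy : v != y by apply: contraTneq yv => ->.
  have [|e|e] := @tree_edge v y; first by rewrite /edge yv.
    rewrite /up e eqxx andbT; have [vr|//] := eqVneq v r.
    by move: vNy; rewrite -e vr par_root eqxx.
  rewrite addnC /up e eqxx andbT; have [yr|//] := eqVneq y r.
  by move: vNy; rewrite -e yr par_root eqxx.
by rewrite [X in _ + X]exchange_big /= mul2n -addnn leq_add.
Qed.

(** The child of [r] above [w], with [branch r = r]. *)
Definition branch w := iter (h w).-1 par w.

Lemma branch_edge x y : edge s x y -> x != r -> y != r -> branch x = branch y.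
Proof.
have imp a b : par a = b -> a != r -> b != r -> branch a = branch b.
  move=> ab ar br; have [_ ha] := parP ar; rewrite /branch ha ab /=.
  move: br; rewrite -h_gt0; case: (h b) => // m _.
  by rewrite /= -iterS iterSr ab.
by move=> /tree_edge[] e xr yr; [apply: imp|apply/esym/imp].
Qed.

(** [branch] is constant along walks avoiding [r], so the geodesic passes through [r]. *)
Lemma gd_branch v w : v != r -> w != r -> branch v != branch w ->
  gd s v w = h v + h w.
Proof.
move=> vr wr bvw; have [p [pp lp _ gp]] := gd_path conn v w.
suff /gp -> : r \in v :: p by rewrite (gd_sym s v).
apply: contraR bvw => rp; apply/eqP; rewrite -lp.
elim: p v pp rp {vr lp gp} => //= z p IHp v /andP[vz pp].
rewrite !inE !negb_or => /and3P[rv rz rp].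
rewrite (branch_edge vz) 1?eq_sym //; apply: IHp => //.
by rewrite !inE negb_or rz.
Qed.

Lemma gd_climb k w : gd s (iter k par w) w <= k.
Proof.
elim: k => [|k IHk] /=; first by rewrite gd_refl.
have [e|/parP[e _]] := eqVneq (iter k par w) r.
  by rewrite e par_root -e ltnW.
by apply: leq_trans (gd_edge conn w _) _; [rewrite edge_sym; exact: e|].
Qed.

(** The root is a centroid: stepping from [r] to [branch v] gains one for each vertex of that branch
    and loses at most one for any other. *)
Lemma card_branch v : v != r ->
  2 * #|[set w | (w != r) && (branch w == branch v)]| <= n.
Proof.
move=> vr; set T := [set w | _]; have := rmin (branch v).
suff : dsum (branch v) + 2 * #|T| <= dsum r + n by lia.
have hb : h (branch v) = 1 by rewrite h_iter; move: vr; rewrite -h_gt0; lia.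
rewrite -[in _ + n](card_ord n) -!sum1_card big_distrr /= /dsum.
rewrite [X in _ + X <= _]big_mkcond -!big_split; apply: leq_sum => w _ /=.
case: ifP => [|_]; last first.
  have := gd_tri conn (branch v) r w; rewrite (gd_sym s _ r) hb; lia.
rewrite inE -h_gt0 => /andP[h1 /eqP <-].
by have := gd_climb (h w).-1 w; rewrite -/(branch w); lia.
Qed.

Variable a : nat.
(** The condition against buying one more link; [a] will be the integer part of the link price. *)
Hypothesis add : forall u (t : {set 'I_n}) (f : 'I_n -> nat),
  u \notin t -> #|t| <= #|s u|.+1 ->
  (forall w, w \in ball (deviate s u t) (f w) u) -> dsum u <= a + \sum_w f w.

Lemma buy_root v (f : 'I_n -> nat) : v != r ->
  (forall w, gd s v w <= f w \/ h w < f w) -> dsum v <= a + \sum_w f w.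
Proof.
move=> vr fP; apply: (@add v (r |: s v)).
- by rewrite !inE (negPf vr) (negPf (irr v)).
- by rewrite cardsU1 -add1n leq_add2r leq_b1.
have mono k x y : y \in ball s k x -> y \in ball (deviate s v (r |: s v)) k x.
  case/ballP=> p [pp lp sp]; apply/ballP; exists p; split=> //.
  apply: sub_path pp => b c bc; apply: dev_edge => // _; rewrite !inE => ->;
  exact: orbT.
move=> w; case: (fP w) => le; first exact/(ball_le le)/mono/gd_ball.
apply: (ball_le le); rewrite -add1n; apply: ball_trans (mono _ _ _ (gd_ball conn _ _)).
by apply: ball_edge; rewrite /edge !ffunE eqxx !inE eqxx.
Qed.

(** A link to [r] shortens the distance from [h v + h w] to at most [h w + 1] for every [w] outside
    the branch of [v], which is at least half of the vertices. *)
Lemma root_depth v : v != r -> n * (h v).-1 <= 2 * a.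
Proof.
move=> vr; set T := [set w | (w != r) && (branch w == branch v)].
have cT : 2 * #|T| <= n := card_branch vr.
have := @buy_root v (fun w => if w \in T then gd s v w else (h w).+1) vr.
have hv : 0 < h v by rewrite h_gt0.
move=> H.
have : dsum v <= a + \sum_w (if w \in T then gd s v w else (h w).+1).
  by apply: H => w; case: ifP; [left|right].
have : \sum_w (if w \in T then gd s v w else (h w).+1) + #|~: T| * (h v).-1 <= dsum v.
  rewrite -sum_nat_const [X in _ + X]big_mkcond -big_split; apply: leq_sum => w _ /=.
  rewrite in_setC; case: ifP => [|] wT; first by rewrite addn0.
  have [->|wr] := eqVneq w r; first by rewrite h0 (gd_sym s v) /=; clear -hv; lia.
  have bvw : branch v != branch w by move: wT; rewrite inE wr /= eq_sym => ->.
  by rewrite (gd_branch vr wr bvw) /=; clear -hv; lia.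
have := cardsC T; rewrite card_ord.
move: (\sum_w _) (dsum v) #|T| #|~: T| (h v).-1 cT => S D x y z *; nia.
Qed.

(** Depth bounds control [dsum r]; any other vertex could link to [r], so its sum is at most
    [a + n + dsum r]. *)
Lemma sum_dsum : \sum_u dsum u <= n.-1 * (3 * a + 2 * n).
Proof.
have le_r : n * dsum r <= n.-1 * (n + 2 * a).
  rewrite /dsum (bigD1 r) //= h0 add0n big_distrr /= -sum_neq_root big_distrl /=.
  apply: leq_sum => w wr; have := root_depth wr; move: wr; rewrite -h_gt0.
  by case: (h w) => // m _ /=; lia.
have le_v v : v != r -> dsum v <= a + n + dsum r.
  move=> vr; have := @buy_root v (fun w => h w + 1) vr.
  rewrite big_split /= sum_nat_const card_ord -/(dsum r) => H.
  rewrite [a + n + _]addnAC -addnA -[n]muln1; apply: H => w.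
  by right; rewrite addn1.
rewrite (bigD1 r) //=.
have : \sum_(u | u != r) dsum u <= n.-1 * (a + n + dsum r).
  by rewrite -sum_neq_root big_distrl /=; apply: leq_sum => v /le_v; rewrite mul1n.
move: (\sum_(_ | _) _) (dsum r) n.-1 (ltn_predK (ltn_ord r)) le_r.
by clear => S D m; case: n => // k [->]; nia.
Qed.

End Deviations.

(** * Real-valued costs and the two social cost bounds *)

Section Costs.
Variables (R : realType) (n : nat) (alpha : R).
Hypothesis alpha_ge0 : (0 <= alpha)%R.
Implicit Type s : strat n.

Local Notation cost := (@player_cost R n alpha).

Lemma cost_conn s u : (forall v, v \in ball s n u) ->
  cost s u = (alpha * #|s u|%:R + (dsum s u)%:R)%:E%R.
Proof.
move=> conn; rewrite /player_cost EFinD; congr (_ + _)%E.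
rewrite /dsum natr_sum -sumEFin [RHS](bigD1 u) //= gd_refl add0e.
by apply: eq_bigr => v _; rewrite /dist conn.
Qed.

Lemma cost_le s u (f : 'I_n -> nat) : (forall w, w \in ball s (f w) u) ->
  (cost s u <= (alpha * #|s u|%:R + (\sum_w f w)%:R)%:E%R)%E.
Proof.
move=> fP; rewrite cost_conn => [|v]; last exact: ball_short (fP v).
by rewrite lee_fin lerD2l ler_nat; apply: leq_sum => w _; apply: gd_min.
Qed.

Lemma dist_ge0 s u v : (0 <= dist R s u v)%E.
Proof. by rewrite /dist; case: ifP => _; rewrite ?leey // lee_fin ler0n. Qed.

Lemma cost_ge0 s u : (0 <= cost s u)%E.
Proof.
by rewrite adde_ge0 ?sume_ge0 // => [|v _]; rewrite ?dist_ge0 // lee_fin mulr_ge0.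
Qed.

Lemma cost_lty_conn s u : (cost s u < +oo)%E -> forall v, v \in ball s n u.
Proof.
move=> fin v; apply: contraLR fin => vN; rewrite -leNgt.
have vu : v != u by apply: contraNneq vN => ->; apply: ball_refl.
rewrite /player_cost (bigD1 v) //= {1}/dist (negPf vN) addye ?addey //.
by rewrite gt_eqF // (lt_le_trans (ltNyr 0)) // sume_ge0 // => w _; apply: dist_ge0.
Qed.

(** Linking to everyone has finite cost, so equilibrium costs are finite. *)
Lemma nash_connected s : nash alpha s -> forall u v, v \in ball s n u.
Proof.
case=> _ ne u; apply: cost_lty_conn.
apply: (le_lt_trans (ne u (~: [set u]) _)); first by rewrite /valid_strategy !inE eqxx.
apply: (le_lt_trans (@cost_le _ u (fun=> 1) _)); last exact: ltry.
move=> w; have [->|wu] := eqVneq w u; first exact: ball_refl.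
by apply: ball_edge; rewrite /edge !ffunE eqxx !inE wu.
Qed.

Lemma nash_dsum s u (t : {set 'I_n}) (f : 'I_n -> nat) : nash alpha s ->
  u \notin t -> (forall w, w \in ball (deviate s u t) (f w) u) ->
  (alpha * #|s u|%:R + (dsum s u)%:R <= alpha * #|t|%:R + (\sum_w f w)%:R)%R.
Proof.
move=> ne ut fP; have := ne.2 u t ut.
rewrite (cost_conn (nash_connected ne u)) => /le_trans/(_ (cost_le fP)).
by rewrite lee_fin ffunE eqxx.
Qed.

Lemma social_cost_conn s : (forall u v, v \in ball s n u) ->
  social_cost alpha s = (alpha * (\sum_u #|s u|)%:R + (\sum_u dsum s u)%:R)%:E%R.
Proof.
move=> conn; rewrite /social_cost !natr_sum mulr_sumr -big_split -sumEFin.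
by apply: eq_bigr => u _; apply: cost_conn.
Qed.

(** Each non-root vertex has a parent edge, bought by the parent or by the child; each case is
    bounded by all purchases, whence the factor two. *)
Lemma connected_edges s : (forall u v, v \in ball s n u) ->
  n.-1 <= 2 * \sum_u #|s u|.
Proof.
move=> conn; case: n s conn => // m s conn; pose r := @ord0 m.
have le_in (P : rel 'I_m.+1) : (forall u v, P u v -> v \in s u) ->
    \sum_u \sum_v P u v <= \sum_u #|s u|.
  move=> Ps; apply: leq_sum => u _; rewrite -sum1_card [X in _ <= X]big_mkcond.
  by apply: leq_sum => v _; case: (boolP (P u v)) => // /Ps ->.
apply: (@leq_trans (\sum_u \sum_v ((par s r u == v) && (v \in s u))
                  + \sum_u \sum_v ((par s r v == u) && (v \in s u)))); last first.
  by rewrite mul2n -addnn leq_add // le_in // => u v /andP[].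
rewrite [X in _ + X]exchange_big -big_split -(sum_neq_root r) big_mkcond.
apply: leq_sum => v _; case: ifP => // vr; have [e _] := parP conn vr.
rewrite (bigD1 (par s r v)) //= [X in _ + X](bigD1 (par s r v)) //= !eqxx /=.
by case/orP: e => ->; rewrite ?addnS ?addSn.
Qed.

Lemma social_cost_lb s :
  ((alpha * n.-1%:R)%:E <= 2%:E * social_cost alpha s)%E%R.
Proof.
have [/forallP conn|/forallPn[u /forallPn[v vN]]] :=
    boolP [forall u : 'I_n, forall v, v \in ball s n u].
  have {}conn u v : v \in ball s n u by have /forallP := conn u.
  rewrite social_cost_conn // -EFinM lee_fin mulrDr.
  rewrite -[X in (X <= _)%R]addr0 lerD ?mulr_ge0 ?ler0n // mulrCA.
  by rewrite ler_wpM2l // -natrM ler_nat connected_edges.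
rewrite (_ : social_cost alpha s = +oo%E) ?muley ?leey //.
  by rewrite gt0_muley ?leey // lte_fin ltr0n.
have cu : cost s u = +oo%E.
  apply/eqP; rewrite -leye_eq leNgt; apply: contra vN => /cost_lty_conn; exact.
apply/eqP; rewrite -leye_eq /social_cost (bigD1 u) //= cu.
by rewrite leeDl // sume_ge0 // => w _; apply: cost_ge0.
Qed.

Lemma nash_social_cost s : (9 * n%:R < alpha)%R -> nash alpha s ->
  (social_cost alpha s <= (6 * (alpha * n.-1%:R))%:E)%E%R.
Proof.
move=> lt9 ne; have conn := nash_connected ne.
rewrite social_cost_conn // lee_fin.
have [n0|n_gt0] := posnP n.
  have triv (F : 'I_n -> nat) : \sum_u F u = 0.
    by apply: big1 => u _; have := ltn_ord u; rewrite {2}n0.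
  by rewrite !triv mulr0 addr0 !mulr_ge0.
have irr u : u \notin s u by case: ne => /forallP/(_ u).
have swap u (t : {set 'I_n}) f : u \notin t -> #|t| <= #|s u| ->
    (forall w, w \in ball (deviate s u t) (f w) u) -> dsum s u <= \sum_w f w.
  move=> ut lt fP; have := nash_dsum ne ut fP.
  rewrite -(ler_nat R) => H; rewrite -(lerD2l (alpha * #|s u|%:R)).
  by apply: le_trans H _; rewrite lerD2r ler_wpM2l // ler_nat.
have del u (t : {set 'I_n}) f : u \notin t -> #|t| < #|s u| ->
    (forall w, w \in ball (deviate s u t) (f w) u) ->
    dsum s u + 9 * n < \sum_w f w.
  move=> ut lt fP; have := nash_dsum ne ut fP.
  have : (alpha * #|t|.+1%:R <= alpha * #|s u|%:R)%R by rewrite ler_wpM2l // ler_nat.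
  rewrite -(ltr_nat R) natrD natrM -[#|t|.+1]addn1 natrD; lra.
pose a := Num.truncn alpha.
have aP : (a%:R <= alpha)%R by rewrite -truncn_ge_nat.
have add u (t : {set 'I_n}) f : u \notin t -> #|t| <= #|s u|.+1 ->
    (forall w, w \in ball (deviate s u t) (f w) u) -> dsum s u <= a + \sum_w f w.
  move=> ut lt fP; have := nash_dsum ne ut fP.
  have : (alpha * #|t|%:R <= alpha * #|s u|.+1%:R)%R by rewrite ler_wpM2l // ler_nat.
  (* Distance sums are integers, so an excess over [a] is at least [a + 1 > alpha]. *)
  rewrite leqNgt -[#|s u|.+1]addn1 natrD => H1 H2; apply/negP => H3.
  have : (alpha < a.+1%:R)%R by rewrite -truncn_le_nat.
  have : ((a.+1 + \sum_w f w)%:R <= (dsum s u)%:R :> R)%R by rewrite ler_nat addSn.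
  rewrite natrD; lra.
have [r rmin] : exists r, forall u, dsum s r <= dsum s u.
  case: (@arg_minnP _ (Ordinal n_gt0) xpredT (dsum s) isT) => r _ rmin.
  by exists r => u; apply: rmin.
have := sum_bought irr conn swap del rmin.
rewrite -(ler_nat R) natrM => le_b.
have := sum_dsum irr conn swap del rmin add.
rewrite -(ler_nat R) natrM natrD !natrM => le_d.
have n1 : (0 <= n.-1%:R :> R)%R by rewrite ler0n.
have := ler_wpM2l alpha_ge0 le_b; have := ler_wpM2l n1 aP.
have := ler_wpM2l n1 (ltW lt9).
have : (0 <= alpha * n.-1%:R)%R by rewrite mulr_ge0.
(* Links cost at most [2 alpha (n - 1)], distances at most [(n - 1) (3 alpha + 2 n)], and
   [2 n <= alpha]; hence the 6. *)
nra.
Qed.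

End Costs.

Local Open Scope ring_scope.

Theorem theorem3 (R : realType) :
  exists c : R, forall (n : nat) (alpha : R),
    9 * n%:R < alpha -> poa_le n alpha c.
Proof.
(* The equilibrium bound contributes 6, the lower bound on any social cost a factor 2. *)
exists 12 => n alpha lt9 s s' ne _.
have alpha_ge0 : 0 <= alpha by apply: le_trans (ltW lt9); rewrite mulr_ge0.
apply: le_trans (nash_social_cost alpha_ge0 lt9 ne) _.
rewrite EFinM (_ : 12%:E = 6%:E * 2%:E)%E; last by rewrite -EFinM -natrM.
by rewrite -muleA lee_pmul2l ?lte_fin ?ltr0n // social_cost_lb.
Qed.
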